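(* Let $k\ge 1$ be an integer, $x\in\{3,4,5\}$ and $\theta = 2\pi/(4k+x)$. Define $\boldsymbol{c} = 1/(\cos(\theta/2)-\sin(\theta/2))$ if $x=4$, and $\boldsymbol{c} = \cos(\theta/4)/(\cos(\theta/2)-\sin(3\theta/4))$ if $x\in\{3,5\}$ (in all cases $\boldsymbol{c}\ge 1$). Let $P$ be a finite set of points in general position and $S$ a set of constraints on $P$. Let $u,w\in P$ be two vertices such that $u$ can see $w$, let $m$ be the midpoint of the side of the canonical triangle $T_{uw}$ opposite $u$, and let $\alpha$ be the unsigned angle between $uw$ and $um$. Then there exists a path connecting $u$ and $w$ in the constrained $\theta_{(4k+x)}$-graph of $P$ with respect to $S$ of length at most \[\left( \frac{\cos \alpha}{\cos \left(\frac{\theta}{2}\right)} + \left(\cos \alpha \cdot \tan \left(\frac{\theta}{2}\right) + \sin \alpha\right) \cdot \boldsymbol{c} \right) \cdot |u w|.\]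
   Context: $P$ is a finite set of points in the plane and $S$ is a set of line segments (called constraints), each joining two points of $P$, such that no two constraints intersect properly. Two points $u,v\in P$ can see each other if and only if the segment $uv$ does not properly intersect any constraint or $uv$ is itself a constraint. Fix an integer $k\ge 1$, $x\in\{2,3,4,5\}$ and $\theta=2\pi/(4k+x)$. Around each point $u$, the $4k+x$ rays from $u$ with angle $\theta$ between consecutive rays define cones; they are oriented so that the bisector of one cone, $C_0^u$, is the vertical half-line above $u$, and the cones are numbered $C_0^u, C_1^u, \dots$ clockwise; all points use the same orientation. For every constraint $uv$ with $v\in C_i^u$, the line through that constraint splits $C_i^u$; the resulting pieces are the subcones of $C_i^u$ (if a constraint $uv$ splits a cone of $u$ into two subcones, $v$ is considered to lie in both; a cone not split is a single subcone). The constrained $\theta_{(4k+x)}$-graph has vertex set $P$ and, for each vertex $u$ and each subcone of each cone $C_i^u$, an edge between $u$ and the vertex $v$ of that subcone that can see $u$ and whose orthogonal projection onto the bisector of the full cone $C_i^u$ (not of the subcone) is closest to $u$ among all vertices of that subcone that can see $u$. Edges are weighted by Euclidean length, and the length of a path is the sum of its edge lengths. General position: no two points lie on a line parallel to one of the rays defining the cones, no two points lie on a line perpendicular to the bisector of a cone, and no three points are collinear. For a vertex $w$ in cone $C_i^u$, the canonical triangle $T_{uw}$ is the triangle bounded by the two boundary rays of $C_i^u$ and the line through $w$ perpendicular to the bisector of $C_i^u$. *)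

(* Defs.v *)
From Stdlib Require Import Reals Lra List.
Open Scope R_scope.

Definition pt := (R * R)%type.

Definition vsub (p q : pt) : pt := (fst p - fst q, snd p - snd q).
Definition dot (p q : pt) : R := fst p * fst q + snd p * snd q.
Definition cross (p q : pt) : R := fst p * snd q - snd p * fst q.
Definition norm (p : pt) : R := sqrt (dot p p).
Definition pdist (p q : pt) : R := norm (vsub q p).
Definition orient (a b c : pt) : R := cross (vsub b a) (vsub c a).

(** Unit vector whose clockwise angle from the upward vertical is [beta]. *)
Definition cdir (beta : R) : pt := (sin beta, cos beta).

Definition theta (n : nat) : R := 2 * PI / INR n.

(** [v] lies in the (open) cone [C_i^u] with angular offset [t] from the
    bisector (bisector of C_i has clockwise angle i*theta from the vertical). *)
Definition cone_offset (n : nat) (u : pt) (i : nat) (v : pt) (t : R) : Prop :=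
  - (theta n / 2) < t < theta n / 2 /\
  exists r, 0 < r /\
    v = (fst u + r * fst (cdir (INR i * theta n + t)),
         snd u + r * snd (cdir (INR i * theta n + t))).

Definition in_cone (n : nat) (u : pt) (i : nat) (v : pt) : Prop :=
  exists t, cone_offset n u i v t.

Definition bis_proj (n : nat) (u : pt) (i : nat) (v : pt) : R :=
  dot (vsub v u) (cdir (INR i * theta n)).

Definition is_constraint (S : list (pt * pt)) (a b : pt) : Prop :=
  In (a, b) S \/ In (b, a) S.

Definition proper_cross (a b c d : pt) : Prop :=
  orient a b c * orient a b d < 0 /\ orient c d a * orient c d b < 0.

Definition sees (S : list (pt * pt)) (u v : pt) : Prop :=
  is_constraint S u v \/
  (forall c, In c S -> ~ proper_cross u v (fst c) (snd c)).

Definition constr_offset (n : nat) (S : list (pt * pt)) (u : pt) (i : nat) (t : R)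
  : Prop :=
  exists z, is_constraint S u z /\ cone_offset n u i z t.

Definition is_subcone (n : nat) (S : list (pt * pt)) (u : pt) (i : nat) (a b : R)
  : Prop :=
  - (theta n / 2) <= a /\ a < b /\ b <= theta n / 2 /\
  (a = - (theta n / 2) \/ constr_offset n S u i a) /\
  (b = theta n / 2 \/ constr_offset n S u i b) /\
  (forall t, a < t < b -> ~ constr_offset n S u i t).

Definition in_subcone (n : nat) (u : pt) (i : nat) (a b : R) (v : pt) : Prop :=
  exists t, cone_offset n u i v t /\ a <= t <= b.

Definition theta_choice (n : nat) (P : list pt) (S : list (pt * pt)) (u v : pt)
  : Prop :=
  In u P /\ In v P /\
  exists i a b, (i < n)%nat /\ is_subcone n S u i a b /\
    in_subcone n u i a b v /\ sees S u v /\
    (forall z, In z P -> in_subcone n u i a b z -> sees S u z ->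
       bis_proj n u i v <= bis_proj n u i z).

Definition ctheta_edge (n : nat) (P : list pt) (S : list (pt * pt)) (u v : pt)
  : Prop :=
  theta_choice n P S u v \/ theta_choice n P S v u.

(** Paths: [gpath E u l w] says u, l_1, ..., l_m (= w) is a path. *)
Fixpoint gpath (E : pt -> pt -> Prop) (u : pt) (l : list pt) (w : pt) : Prop :=
  match l with
  | nil => u = w
  | v :: l' => E u v /\ gpath E v l' w
  end.

Fixpoint path_length (u : pt) (l : list pt) : R :=
  match l with
  | nil => 0
  | v :: l' => pdist u v + path_length v l'
  end.

Definition general_position (n : nat) (P : list pt) : Prop :=
  (forall p q, In p P -> In q P -> p <> q ->
     forall j : nat, cross (vsub q p) (cdir ((2 * INR j + 1) * (theta n / 2))) <> 0) /\
  (forall p q, In p P -> In q P -> p <> q ->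
     forall j : nat, dot (vsub q p) (cdir (INR j * theta n)) <> 0) /\
  (forall p q r, In p P -> In q P -> In r P -> p <> q -> q <> r -> p <> r ->
     orient p q r <> 0).

Definition valid_constraints (P : list pt) (S : list (pt * pt)) : Prop :=
  (forall c, In c S -> In (fst c) P /\ In (snd c) P /\ fst c <> snd c) /\
  (forall c d, In c S -> In d S ->
     ~ proper_cross (fst c) (snd c) (fst d) (snd d)).

Definition vangle (p q : pt) : R := acos (dot p q / (norm p * norm q)).

Definition cconst (x : nat) (th : R) : R :=
  if Nat.eqb x 4 then 1 / (cos (th / 2) - sin (th / 2))
  else cos (th / 4) / (cos (th / 2) - sin (3 * th / 4)).

(* Main.v *)
(** Write [(s, h)] for the coordinates of [w - u] across and along the bisector
    of the cone of [u] containing [w]. The bound of the theorem is the cost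
    [F = K h + c |s|] with [K = 1 / cos (theta/2) + c tan (theta/2)], and we show
    that the graph distance is at most [F] by induction on [F], in steps of the
    minimal distance between two points.

    Let [v] be the neighbour of [u] in the subcone of [w], say to the left of [uw].
    Wrapping the points of the triangle [u v w] around from [v] yields a convex
    chain of mutually visible points from [v] to [w], all of whose edges climb in
    the frame of the cone of [u] and point to the right of [uw]. On each side of
    the bisector [K h + c |s|] is linear, so convexity makes the costs of the chain
    edges, measured in the frame of [u], telescope to at most [F - |uv|]. Finally
    each chain edge costs no more in the frame of its own cone than in the frame
    of [u]: with offset [psi] in the [j]-th next cone this is the inequality
    [sin mu <= c cos (mu + theta/2)], [mu = j theta/2 + max psi 0], and the
    constant [c] is exactly its extremal case. *)
Require Import Defs.
From Stdlib Require Import Reals Lra Lia Psatz ZArith List Classical.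
Open Scope R_scope.

(** * Orientations and visibility *)

(* [tau = 1] or [-1] selects the clockwise or the mirrored orientation, so that
   [v] to the left of [uw] covers both sides at once. *)
Definition turn (tau : R) (a b c : pt) : R := tau * orient a c b.

Ltac coords :=
  unfold turn, orient, cross, dot, vsub in *; simpl in *.

Lemma turn_cycle tau a b c : turn tau a b c = turn tau b c a.
Proof. coords; ring. Qed.

Lemma turn_swap tau a b c : turn tau a c b = - turn tau a b c.
Proof. coords; ring. Qed.

Lemma turn_split tau a b c q :
  turn tau a b c = turn tau a b q + turn tau b c q + turn tau c a q.
Proof. coords; ring. Qed.

Lemma turn_degenerate tau a b : turn tau a b b = 0 /\ turn tau a b a = 0 /\ turn tau a a b = 0.
Proof. repeat split; coords; ring. Qed.

(** [turn tau x y] is affine in its last argument, and the weights of [q] in the triangle [a b c]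
    are its turns with the three sides. *)
Lemma turn_barycentric tau x y a b c q :
  turn tau a b c * turn tau x y q =
  turn tau b c q * turn tau x y a + turn tau c a q * turn tau x y b
  + turn tau a b q * turn tau x y c.
Proof. coords; ring. Qed.

Lemma proper_cross_turn tau a b c d : tau * tau = 1 ->
  proper_cross a b c d <->
  turn tau a b c * turn tau a b d < 0 /\ turn tau c d a * turn tau c d b < 0.
Proof.
intros Ht; unfold proper_cross.
assert (E : forall p q r s, turn tau p q r * turn tau p q s = orient p q r * orient p q s).
{ intros p q r s.
  replace (turn tau p q r * turn tau p q s)
    with ((tau * tau) * (orient p q r * orient p q s)) by (coords; ring).
  rewrite Ht; ring. }
rewrite !E; tauto.
Qed.

(** Two points [c], [d] are given by barycentric coordinates, scaled by [D], in a triangle [a b o].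
    The 2x2 minors are then, up to the factor [D], the orientations of [a], [b], [o] with respect to
    the line [cd], so crossings become sign conditions. *)
Lemma crossing_barycentric la lb lo ma mb mo D :
  0 < D -> la + lb + lo = D -> ma + mb + mo = D -> 0 < lo -> mo < 0 ->
  (lb * mo - lo * mb) * (lo * ma - la * mo) < 0 ->
  la * mb - lb * ma <> 0 -> la <> 0 -> lb <> 0 ->
  0 < lb /\ 0 < la \/
  lb < 0 /\ lb * mb < 0 /\ (la * mb - lb * ma) * (lb * mo - lo * mb) < 0 \/
  la < 0 /\ la * ma < 0 /\ (lo * ma - la * mo) * (la * mb - lb * ma) < 0.
Proof.
intros HD Hl Hm Hlo Hmo Hp Hn Ha Hb.
(* The two summands are proportional to the coordinates of the point where [cd] meets the line [ab].
   [Hp] gives them equal signs and their sum is positive, so both are positive. *)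
assert (Hs : 0 < (lo * ma - la * mo) + (lo * mb - lb * mo)).
{ replace (_ + _) with (D * (lo - mo)) by (subst D; nra). nra. }
assert (Ya : 0 < lo * ma - la * mo) by nra.
assert (Yb : 0 < lo * mb - lb * mo) by nra.
destruct (Rlt_dec 0 lb) as [Lb|Lb]; destruct (Rlt_dec 0 la) as [La|La]; [now left| | |].
- assert (la < 0) by lra. right; right.
  assert (0 < ma) by nra.
  assert (la * mb - lb * ma < 0).
  { destruct (Rle_dec 0 mb) as [M|M]; [nra|].
    assert (K1 : lo * ma > - la * - mo) by lra.
    assert (K2 : lb * - mo > lo * - mb) by lra.
    assert (0 < - mb) by lra. assert (0 < - la) by lra.
    assert ((lo * ma) * (lb * - mo) > (- la * - mo) * (lo * - mb)).
    { apply Rlt_gt, Rmult_le_0_lt_compat; nra. }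
    assert (0 < lo * - mo) by nra. nra. }
  repeat split; nra.
- assert (lb < 0) by lra. right; left.
  assert (0 < mb) by nra.
  assert (0 < la * mb - lb * ma).
  { destruct (Rle_dec 0 ma) as [M|M]; [nra|].
    assert (K1 : lo * mb > - lb * - mo) by lra.
    assert (K2 : la * - mo > lo * - ma) by lra.
    assert (0 < - ma) by lra. assert (0 < - lb) by lra.
    assert ((lo * mb) * (la * - mo) > (- lb * - mo) * (lo * - ma)).
    { apply Rlt_gt, Rmult_le_0_lt_compat; nra. }
    assert (0 < lo * - mo) by nra. nra. }
  repeat split; nra.
(* Here [c] lies beyond both sides at [o]; the sign of the remaining minor tells on which side of
   [o] the segment passes. *)
- assert (la < 0) by lra. assert (lb < 0) by lra.
  assert (0 < ma) by nra. assert (0 < mb) by nra. right.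
  destruct (Rlt_dec 0 (la * mb - lb * ma)); [left|right]; repeat split; nra.
Qed.

(* A segment from [d] entering the triangle [o a b] through [ab] either ends
   inside it at [c] or leaves it again through [oa] or [bo]. *)
Lemma segment_through_triangle tau o a b c d :
  0 < turn tau a b o -> 0 < turn tau a b c -> turn tau a b d < 0 ->
  turn tau c d a * turn tau c d b < 0 ->
  turn tau c d o <> 0 -> turn tau o a c <> 0 -> turn tau b o c <> 0 ->
  0 < turn tau o a c /\ 0 < turn tau b o c \/
  turn tau o a c < 0 /\ turn tau o a c * turn tau o a d < 0
    /\ turn tau c d o * turn tau c d a < 0 \/
  turn tau b o c < 0 /\ turn tau b o c * turn tau b o d < 0
    /\ turn tau c d b * turn tau c d o < 0.
Proof.
intros HD Hc Hd Hx Ho Hoa Hbo.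
set (D := turn tau a b o) in *.
assert (Ea : D * turn tau c d a
  = turn tau o a c * turn tau a b d - turn tau a b c * turn tau o a d)
  by (unfold D; coords; ring).
assert (Eb : D * turn tau c d b
  = turn tau a b c * turn tau b o d - turn tau b o c * turn tau a b d)
  by (unfold D; coords; ring).
assert (Eo : D * turn tau c d o
  = turn tau b o c * turn tau o a d - turn tau o a c * turn tau b o d)
  by (unfold D; coords; ring).
assert (HDD : 0 < D * D) by nra.
assert (S2 : forall y z, (D * y) * (D * z) < 0 <-> y * z < 0) by (intros; split; nra).
destruct (crossing_barycentric (turn tau b o c) (turn tau o a c) (turn tau a b c)
  (turn tau b o d) (turn tau o a d) (turn tau a b d) D)
  as [H|[(H1 & H2 & H3)|(H1 & H2 & H3)]]; auto.
- unfold D; coords; ring.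
- unfold D; coords; ring.
- rewrite <- Ea, <- Eb. now apply S2.
- rewrite <- Eo. apply Rmult_integral_contrapositive; split; lra.
- right; left. rewrite <- Ea, <- Eo in H3. apply (proj1 (S2 _ _)) in H3. auto.
- right; right. rewrite <- Eb, <- Eo in H3. apply (proj1 (S2 _ _)) in H3. auto.
Qed.

(** * Wrapping the points of a triangle while keeping visibility *)

Definition in_triangle tau u v w q :=
  0 < turn tau u v q /\ 0 < turn tau v w q /\ 0 < turn tau u q w.

Definition no_three_collinear (P : list pt) :=
  forall p q r, In p P -> In q P -> In r P -> p <> q -> q <> r -> p <> r ->
    orient p q r <> 0.

Lemma no_three_collinear_turn P tau p q r :
  tau * tau = 1 -> no_three_collinear P -> In p P -> In q P -> In r P ->
  p <> q -> q <> r -> p <> r -> turn tau p q r <> 0.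
Proof.
intros Ht HP Hp Hq Hr H1 H2 H3 H. unfold turn in H.
apply Rmult_integral in H as [H|H]; [subst; lra|].
revert H; apply HP; auto.
Qed.

Lemma turn_neq0_distinct tau a b c : turn tau a b c <> 0 -> a <> b /\ b <> c /\ a <> c.
Proof.
intros H; repeat split; intros E; subst; apply H; coords; ring.
Qed.

(** Sight along a constraint is also uncrossed, because constraints do not cross each other. *)
Lemma sees_not_crossed P S a b c d :
  valid_constraints P S -> sees S a b -> is_constraint S c d -> ~ proper_cross a b c d.
Proof.
assert (Y : forall a b c d, proper_cross a b c d -> proper_cross a b d c).
{ intros a' b' c' d'; unfold proper_cross; coords; intros [? ?]; split; lra. }
assert (Z : forall a b c d, proper_cross a b c d -> proper_cross b a c d).
{ intros a' b' c' d'; unfold proper_cross; coords; intros [? ?]; split; lra. }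
intros [_ HS] Hs Hc Hx.
assert (W : forall e, In e S -> ~ proper_cross a b (fst e) (snd e)).
{ destruct Hs as [[H|H]|H]; [| |exact H]; intros e He X.
  - exact (HS _ _ H He X).
  - apply (HS _ _ H He); simpl. now apply Z. }
destruct Hc as [H|H]; apply (W _ H); simpl; auto.
Qed.

Lemma not_crossed_sees tau S a b : tau * tau = 1 ->
  (forall c d, is_constraint S c d -> 0 < turn tau a b c -> turn tau a b d < 0 ->
     ~ turn tau c d a * turn tau c d b < 0) -> sees S a b.
Proof.
intros Ht H; right; intros [c d] He X; simpl in X.
apply (proper_cross_turn tau) in X as [X1 X2]; auto.
destruct (Rlt_dec 0 (turn tau a b c)) as [L|L].
- apply (H c d); [now left|auto|nra|auto].
- apply (H d c); [now right|nra| |].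
  + assert (turn tau a b c <> 0) by nra. lra.
  + replace (turn tau d c a) with (- turn tau c d a) by (coords; ring).
    replace (turn tau d c b) with (- turn tau c d b) by (coords; ring).
    lra.
Qed.

Lemma constraint_in P S c d : valid_constraints P S -> is_constraint S c d ->
  In c P /\ In d P /\ c <> d.
Proof.
intros [H _] [Hc|Hc]; destruct (H _ Hc) as (A & B & C); simpl in *; auto.
Qed.

Lemma list_argmin {A : Type} (f : A -> R) (Q : A -> Prop) (l : list A) :
  (exists x, In x l /\ Q x) ->
  exists x, In x l /\ Q x /\ forall y, In y l -> Q y -> f x <= f y.
Proof.
induction l as [|a l IH]; intros [x [Hx Qx]]; [easy|].
destruct (classic (exists x, In x l /\ Q x)) as [E|E].
- destruct (IH E) as (m & Hm & Qm & Mm).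
  destruct (classic (Q a /\ f a <= f m)) as [[Qa La]|N].
  + exists a; repeat split; [now left|auto|].
    intros y [<-|Hy] Qy; [lra|]. specialize (Mm y Hy Qy); lra.
  + exists m; repeat split; [now right|auto|].
    intros y [<-|Hy] Qy; [|auto].
    destruct (Rle_dec (f m) (f a)); [auto|]. exfalso; apply N; split; [auto|lra].
- destruct Hx as [<-|Hx]; [|exfalso; eauto].
  exists a; repeat split; [now left|auto|].
  intros y [<-|Hy] Qy; [lra|exfalso; eauto].
Qed.

Lemma in_triangle_near tau u v w p q : in_triangle tau u v w p ->
  0 < turn tau u v q -> 0 < turn tau v p q -> 0 < turn tau p u q ->
  in_triangle tau u v w q.
Proof.
intros (H1 & H2 & H3) Q1 Q2 Q3.
assert (E1 := turn_barycentric tau v w u v p q).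
assert (E2 := turn_barycentric tau w u u v p q).
assert (W := turn_split tau u v w p).
rewrite <- (turn_cycle tau w u p) in H3.
destruct (turn_degenerate tau v w) as (_ & D1 & _).
destruct (turn_degenerate tau w u) as (D2 & _ & _).
rewrite D1, <- (turn_cycle tau u v w) in E1.
rewrite D2, (turn_cycle tau w u v) in E2.
rewrite (turn_cycle tau w u p) in *.
repeat split; auto; [|rewrite <- turn_cycle]; nra.
Qed.

Lemma in_triangle_far tau u v w p q : in_triangle tau u v w p ->
  0 < turn tau u p q -> 0 < turn tau p w q -> 0 < turn tau w u q ->
  in_triangle tau u v w q.
Proof.
intros (H1 & H2 & H3) Q1 Q2 Q3.
assert (E1 := turn_barycentric tau u v u p w q).
assert (E2 := turn_barycentric tau v w u p w q).
assert (W := turn_split tau u v w p).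
destruct (turn_degenerate tau u v) as (_ & D1 & _).
destruct (turn_degenerate tau v w) as (D2 & _ & _).
rewrite D1 in E1.
rewrite D2, <- (turn_cycle tau u v w) in E2.
rewrite (turn_cycle tau w u p) in *.
repeat split; [| |rewrite <- turn_cycle]; nra.
Qed.

(** The three-term Plücker relation for the directions of [v], [d], [p], [w] from [u]. *)
Lemma wedge_plucker tau u v d p w :
  turn tau u v p * turn tau u d w
  = turn tau u v d * turn tau u p w + turn tau u v w * turn tau u d p.
Proof. coords; ring. Qed.

(** One step of gift wrapping at [v]: [p] is the candidate whose direction from [v] is closest to
    that of [u], so all other candidates lie on one side of [vp]. *)
Lemma wrapping_point P tau u v w :
  tau * tau = 1 -> no_three_collinear P -> In v P -> In w P ->
  0 < turn tau u v w ->
  exists p, In p P /\ (p = w \/ in_triangle tau u v w p) /\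
    forall q, In q P -> q = w \/ in_triangle tau u v w q -> q <> p -> 0 < turn tau v q p.
Proof.
intros Ht HP Hv Hw HD.
(* This ratio of areas depends only on the direction of [vq]; it is 0 at [w] and grows as the
   direction turns from [vw] towards [vu]. *)
destruct (list_argmin (fun q => - (turn tau v w q / turn tau u v q))
  (fun q => q = w \/ in_triangle tau u v w q) P) as (p & Hp & Qp & M);
  [exists w; auto|].
exists p; repeat split; auto.
intros q Hq Qq Hn. specialize (M q Hq Qq).
assert (A : forall q, q = w \/ in_triangle tau u v w q -> 0 < turn tau u v q).
{ intros r [->|(R1 & _)]; auto. }
assert (Ap := A p Qp). assert (Aq := A q Qq).
assert (L : turn tau v w q * turn tau u v p <= turn tau v w p * turn tau u v q).
{ assert (M' : turn tau v w q / turn tau u v q <= turn tau v w p / turn tau u v p) by lra.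
  apply (Rmult_le_compat_r (turn tau u v p * turn tau u v q)) in M'; [|nra].
  field_simplify in M'; lra. }
assert (E : turn tau v w p * turn tau u v q - turn tau v w q * turn tau u v p
            = turn tau u v w * turn tau v q p) by (coords; ring).
assert (turn tau v q p <> 0).
{ assert (B := turn_neq0_distinct tau u v q ltac:(lra)).
  assert (C := turn_neq0_distinct tau u v p ltac:(lra)).
  eapply no_three_collinear_turn; eauto; intuition congruence. }
nra.
Qed.

(** By the choice of [p], the triangle [u v p] contains no point of [P]. A constraint crossing [up]
    or [vp] would have to end in an empty region, cross a segment of sight, or start at [u] inside
    the wedge. *)
Lemma visible_step P S tau u v w :
  tau * tau = 1 -> no_three_collinear P -> valid_constraints P S ->
  In u P -> In v P -> In w P -> 0 < turn tau u v w ->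
  sees S u v -> sees S u w ->
  (forall z, is_constraint S u z -> ~ (0 < turn tau u v z /\ 0 < turn tau u z w)) ->
  exists p, In p P /\ (p = w \/ in_triangle tau u v w p) /\ sees S u p /\ sees S v p /\
    forall q, In q P -> q = w \/ in_triangle tau u v w q -> q <> p -> 0 < turn tau v q p.
Proof.
intros Ht HP HS Hu Hv Hw HD Suv Suw Hfree.
destruct (wrapping_point P tau u v w) as (p & Hp & Qp & M); auto.
assert (Hext : forall q, In q P -> in_triangle tau u v w q -> ~ 0 < turn tau v p q).
{ intros q Hq Tq X. destruct (turn_neq0_distinct tau v p q ltac:(lra)) as (_ & N & _).
  specialize (M q Hq (or_intror Tq) ltac:(congruence)).
  rewrite turn_swap in X; lra. }
assert (Huvp : 0 < turn tau u v p).
{ destruct Qp as [->|(R1 & _)]; auto. }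
assert (Hnear : forall q, In q P ->
  0 < turn tau u v q -> 0 < turn tau v p q -> 0 < turn tau p u q -> False).
{ intros q Hq A B C. apply (Hext q Hq); auto. destruct Qp as [->|Tp].
  - repeat split; auto. now rewrite <- turn_cycle.
  - eapply in_triangle_near; eauto. }
assert (gp := fun a b c => no_three_collinear_turn P tau a b c Ht HP).
assert (Hcross : forall a b c d, sees S a b -> is_constraint S c d ->
  turn tau a b c * turn tau a b d < 0 -> turn tau c d a * turn tau c d b < 0 -> False).
{ intros a b c d X Y Z W. apply (sees_not_crossed P S a b c d HS X Y).
  now apply (proper_cross_turn tau). }
assert (Sup : sees S u p).
{ destruct Qp as [->|Tp]; auto.
  destruct Tp as (T1 & T2 & T3).
  apply (not_crossed_sees tau); auto. intros c d Hc Uc Ud X.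
  destruct (constraint_in P S c d HS Hc) as (Pc & Pd & Ncd).
  destruct (turn_neq0_distinct tau u p c ltac:(lra)) as (Nup & Npc & Nuc).
  destruct (turn_neq0_distinct tau u p d ltac:(lra)) as (_ & Npd & Nud).
  destruct (turn_neq0_distinct tau u v p ltac:(lra)) as (Nuv & Nvp & _).
  destruct (turn_neq0_distinct tau u v w ltac:(lra)) as (_ & Nvw & Nuw).
  destruct (turn_neq0_distinct tau v w p ltac:(lra)) as (_ & Nwp & _).
  destruct (Rlt_dec 0 (turn tau v p c)) as [L|L].
  (* [c] is on the [u] side of [vp], and the constraint enters the triangle [w u p] through [up].
     Ending inside contradicts wrapping, leaving through [uw] contradicts [Suw], and [E] keeps [c]
     on the inner side of [pw]. *)
  - assert (Ncw : c <> w).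
    { intros ->. rewrite turn_swap in L. lra. }
    assert (Ndw : d <> w) by (intros ->; lra).
    destruct (segment_through_triangle tau w u p c d) as [[A B]|[(A & B & C)|(A & B & C)]]; auto.
    + apply (Hext c Pc); auto. eapply in_triangle_far; repeat split; eauto.
    + apply (Hcross u w c d); auto.
      * replace (turn tau u w c) with (- turn tau w u c) by (coords; ring).
        replace (turn tau u w d) with (- turn tau w u d) by (coords; ring). lra.
      * lra.
    + assert (E : turn tau u v p * turn tau p w c
        = turn tau v w p * turn tau u p c + turn tau u p w * turn tau v p c)
        by (coords; ring).
      nra.
  (* [c] is not on the [u] side of [vp], so [d] is. Read from [c], the constraint enters [u v p]
     through [up]: it cannot end there by [Hnear], nor leave through [uv] by [Suv], nor through [vp]
     by [Ld]. *)
  - assert (Ld : 0 < turn tau v p d).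
    { assert (E : turn tau v p d * turn tau u p c - turn tau v p c * turn tau u p d
        = turn tau c d p * turn tau u v p) by (coords; ring).
      assert (E2 : turn tau u p c - turn tau u p d = turn tau c d p - turn tau c d u)
        by (coords; ring).
      assert (0 < turn tau c d p) by nra.
      assert (0 < turn tau c d p * turn tau u v p) by nra.
      assert (0 <= turn tau v p c * turn tau u p d) by nra.
      nra. }
    assert (Ndv : d <> v).
    { intros ->. destruct (turn_degenerate tau v p) as (_ & Z & _). lra. }
    assert (Ncv : c <> v).
    { intros ->. rewrite <- turn_cycle, turn_swap, <- turn_cycle in Uc.
      replace (turn tau p v u) with (- turn tau u v p) in Uc by (coords; ring). lra. }
    assert (Epc : turn tau p u c = - turn tau u p c) by (coords; ring).
    assert (Epd : turn tau p u d = - turn tau u p d) by (coords; ring).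
    assert (Euvp : turn tau p u v = turn tau u v p) by (coords; ring).
    assert (Edp : turn tau d c p = - turn tau c d p) by (coords; ring).
    assert (Edu : turn tau d c u = - turn tau c d u) by (coords; ring).
    destruct (segment_through_triangle tau v p u d c) as [[A B]|[(A & B & C)|(A & B & C)]];
      auto; try lra.
    + nra.
    + apply (Hnear d); auto; lra.
    + apply (Hcross u v d c); auto. destruct Hc; [right|left]; auto. }
assert (Svp : sees S v p).
{ apply (not_crossed_sees tau); auto. intros c d Hc Uc Ud X.
  destruct (constraint_in P S c d HS Hc) as (Pc & Pd & Ncd).
  destruct (turn_neq0_distinct tau v p c ltac:(lra)) as (Nvp & Npc & Nvc).
  destruct (turn_neq0_distinct tau v p d ltac:(lra)) as (_ & Npd & Nvd).
  destruct (turn_neq0_distinct tau u v p ltac:(lra)) as (Nuv & _ & Nup).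
  assert (Evpu : turn tau v p u = turn tau u v p) by (coords; ring).
  assert (Ndu : d <> u) by (intros ->; lra).
  (* A constraint at [u] crossing [vp] would run inside the wedge, against [Hfree]. Any other one
     enters [u v p] through [vp] and is stopped by [Hnear], [Suv] or the visibility [Sup] just
     proved. *)
  destruct (classic (c = u)) as [->|Ncu].
  - assert (E := turn_split tau u v p d).
    assert (E1 : turn tau u d v = - turn tau u v d) by (coords; ring).
    assert (E2 : turn tau p u d = turn tau u d p) by (coords; ring).
    assert (A : 0 < turn tau u v d) by nra.
    assert (B : 0 < turn tau u d p) by nra.
    apply (Hfree d Hc); split; auto.
    destruct Qp as [->|(T1 & T2 & T3)]; auto.
    assert (E3 := wedge_plucker tau u v d p w). nra.
  - destruct (segment_through_triangle tau u v p c d) as [[A B]|[(A & B & C)|(A & B & C)]];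
      auto; try lra.
    + eapply (Hnear c); auto.
    + apply (Hcross u v c d); auto.
    + apply (Hcross u p c d); auto.
      * replace (turn tau u p c) with (- turn tau p u c) by (coords; ring).
        replace (turn tau u p d) with (- turn tau p u d) by (coords; ring). lra.
      * lra. }
exists p; auto 10.
Qed.

(* The lower convex chain from [v] to [w] as seen from [u]: its vertices turn
   towards the line [uw]. *)
Inductive visible_chain (P : list pt) (S : list (pt * pt)) (tau : R) (u w : pt) :
  pt -> list pt -> Prop :=
| visible_chain_nil : visible_chain P S tau u w w nil
| visible_chain_cons v p l :
    In p P -> sees S u p -> sees S v p ->
    0 < turn tau u v w -> (p = w \/ in_triangle tau u v w p) ->
    (forall q, hd_error l = Some q -> 0 < turn tau v q p) ->
    visible_chain P S tau u w p l -> visible_chain P S tau u w v (p :: l).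

Lemma pt_eq_dec (p q : pt) : {p = q} + {p <> q}.
Proof. decide equality; apply Req_dec_T. Defined.

Lemma visible_chain_exists P S tau u v w :
  tau * tau = 1 -> no_three_collinear P -> valid_constraints P S ->
  In u P -> In v P -> In w P -> 0 < turn tau u v w ->
  sees S u v -> sees S u w ->
  (forall z, is_constraint S u z -> ~ (0 < turn tau u v z /\ 0 < turn tau u z w)) ->
  exists l, visible_chain P S tau u w v l.
Proof.
intros Ht HP HS Hu Hv Hw HD Suv Suw Hfree.
(* [Q] covers the points of the current triangle and loses [p] at each step. The extra information
   on the head of the chain lets the wrapping property of [p] supply the convexity condition. *)
assert (Main : forall N Q v, (length Q < N)%nat ->
  (forall q, In q P -> in_triangle tau u v w q -> In q Q) ->
  In v P -> 0 < turn tau u v w -> sees S u v ->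
  (forall z, is_constraint S u z -> ~ (0 < turn tau u v z /\ 0 < turn tau u z w)) ->
  exists l, visible_chain P S tau u w v l /\
    forall q, hd_error l = Some q -> In q P /\ (q = w \/ in_triangle tau u v w q)).
2: { destruct (Main (Datatypes.S (length P)) P v) as (l & Hl & _); eauto. }
clear v Hv HD Suv Hfree.
induction N as [|N IH]; intros Q v HN HQ Hv HD Suv Hfree; [lia|].
destruct (visible_step P S tau u v w) as (p & Hp & Qp & Sup & Svp & M); auto.
destruct Qp as [->|Tp].
- exists (w :: nil); split; [|intros q [= <-]; auto].
  constructor; auto; [easy|constructor].
- destruct (IH (remove pt_eq_dec p Q) p) as (l & Hl & Hhd); auto.
  + assert (X := remove_length_lt pt_eq_dec Q p (HQ p Hp Tp)). lia.
  + intros q Hq (A & B & C). apply in_in_remove.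
    * intros ->. destruct (turn_degenerate tau u p) as (Z & _). lra.
    * apply HQ; auto. eapply in_triangle_far; eauto. now rewrite turn_cycle.
  + apply Tp.
  + intros z Hz (A & B). apply (Hfree z Hz); split; auto.
    destruct Tp as (T1 & T2 & T3).
    assert (E := wedge_plucker tau u v p z w).
    assert (E' : turn tau u p w * turn tau u v z
      = turn tau u v p * turn tau u z w + turn tau u v w * turn tau u p z)
      by (coords; ring).
    nra.
  + exists (p :: l); split; [|intros q [= <-]; auto].
    constructor; auto.
    intros q Hq. destruct (Hhd q Hq) as [Pq Tq]. apply M; auto.
    * destruct Tq as [->|(A & B & C)]; auto. right.
      eapply in_triangle_far; eauto. now rewrite turn_cycle.
    * destruct Tp as (T1 & T2 & T3).
      intros ->. destruct Tq as [->|(A & _)].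
      -- destruct (turn_degenerate tau u w) as (Z & _). lra.
      -- destruct (turn_degenerate tau u p) as (Z & _). lra.
Qed.

(** * Costs along the chain *)

Fixpoint path_cost (G : pt -> pt -> R) (v : pt) (l : list pt) : R :=
  match l with
  | nil => 0
  | p :: l' => G v p + path_cost G p l'
  end.

Definition frame_cost (K c : R) (h X : pt -> R) (a b : pt) : R :=
  K * (h b - h a) + c * Rabs (X b - X a).

(** With [u] as origin of the coordinates [h], [X], the last inequality compares slopes: [ab] leans
    at least as far to the positive [X] side as [uw]. *)
Definition chain_edge (P : list pt) (S : list (pt * pt)) (h X : pt -> R) (w a b : pt) : Prop :=
  In b P /\ sees S a b /\ h a < h b /\ (h b - h a) * X w <= (X b - X a) * h w.

(* The last conjunct is the part of the chain that leans away from [w]'s side: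
   by convexity it never leans back, so its horizontal displacements telescope. *)
Lemma visible_chain_cost P S tau u w v l (h X : pt -> R) K c :
  (forall p q r, turn tau p q r = (h q - h p) * (X r - X p) - (h r - h p) * (X q - X p)) ->
  h u = 0 -> X u = 0 -> 0 < h w -> 0 <= c ->
  visible_chain P S tau u w v l ->
  0 < h v -> (forall p, hd_error l = Some p -> h v < h p) ->
  gpath (chain_edge P S h X w) v l w /\
  path_cost (frame_cost K c h X) v l <= K * (h w - h v) + c * (Rabs (X w) - X v) /\
  (forall p, hd_error l = Some p -> X p < X v -> X v < 0 ->
     path_cost (frame_cost K c h X) v l <= K * (h w - h v) + c * (X v - X w)).
Proof.
intros ET hu Xu hw hc Hch.
induction Hch as [|v p l Hp Sup Svp HD Qp Hturn Hch IH]; intros hv Hup.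
{ simpl; repeat split; [|easy]. assert (A := Rle_abs (X w)). nra. }
specialize (Hup p eq_refl).
assert (Tp : 0 < turn tau u v p) by (destruct Qp as [->|(? & _)]; auto).
assert (Tr : turn tau u p w <= turn tau u v w).
{ destruct Qp as [->|(A & B & C)].
  - destruct (turn_degenerate tau u w) as (Z & _). lra.
  - rewrite (turn_split tau u v w p), (turn_cycle tau w u p). lra. }
assert (Tnext : forall q, hd_error l = Some q ->
  0 < turn tau v q p /\ 0 < turn tau u p q).
{ intros q Hq. split; auto. destruct Hch as [|? p' ? ? ? ? Hpw Qq]; [easy|].
  injection Hq as ->. destruct Qq as [->|(? & _)]; auto. }
(* [EH] and [EX] write the next edge [pq] as a positive combination of the edge [vp] and the vector
   [up]; this propagates both climbing and leaning away along the chain. *)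
assert (EH : forall q, turn tau u v p * (h q - h p)
   = turn tau u p q * (h p - h v) + turn tau v q p * h p).
{ intros q. rewrite !ET, hu, Xu. ring. }
assert (EX : forall q, turn tau u v p * (X q - X p)
   = turn tau u p q * (X p - X v) + turn tau v q p * X p).
{ intros q. rewrite !ET, hu, Xu. ring. }
rewrite (ET u p w), (ET u v w), hu, Xu in Tr.
rewrite ET, hu, Xu in Tp.
destruct IH as (IH1 & IH2 & IH3); [lra| |].
{ intros q Hq. destruct (Tnext q Hq) as [T1 T2]. specialize (EH q).
  assert (0 < turn tau u p q * (h p - h v)) by nra.
  assert (0 < turn tau v q p * h p) by nra.
  rewrite (ET u v p), hu, Xu in EH. nra. }
assert (C3 : X p < X v -> X v < 0 ->
   path_cost (frame_cost K c h X) v (p :: l) <= K * (h w - h v) + c * (X v - X w)).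
{ intros L1 L2. simpl. unfold frame_cost at 1. rewrite Rabs_left by lra.
  destruct l as [|q l].
  - inversion Hch; subst. simpl. lra.
  - destruct (Tnext q eq_refl) as [T1 T2]. specialize (EX q).
    assert (turn tau u p q * (X p - X v) < 0) by nra.
    assert (turn tau v q p * X p < 0) by nra.
    rewrite (ET u v p), hu, Xu in EX.
    assert (X q < X p) by nra.
    specialize (IH3 q eq_refl ltac:(auto) ltac:(lra)). lra. }
repeat split; auto.
- nra.
- destruct (Rlt_dec (X p) (X v)) as [L|L].
  (* [p] is higher than [v] and to the right of the ray [uv], so leaning left is possible only if
     that ray itself leans left. *)
  + assert (L2 : X v < 0) by nra.
    specialize (C3 L L2). assert (A := Rabs_pos (X w)).
    assert (- X w <= Rabs (X w)) by (rewrite <- Rabs_Ropp; apply Rle_abs). nra.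
  + simpl. unfold frame_cost at 1. rewrite Rabs_right by lra. lra.
- intros q [= <-]; auto.
Qed.

(** * Replacing the edges of a chain by graph paths *)

Lemma gpath_app E a l b l' c : gpath E a l b -> gpath E b l' c -> gpath E a (l ++ l') c.
Proof.
revert a; induction l as [|p l IH]; simpl; intros a H H'; [now subst|].
destruct H; split; auto.
Qed.

Lemma path_length_app E a l b l' :
  gpath E a l b -> path_length a (l ++ l') = path_length a l + path_length b l'.
Proof.
revert a; induction l as [|p l IH]; simpl; intros a H; [subst; ring|].
destruct H as [_ H]; rewrite (IH p H); ring.
Qed.

(** Costs are nonnegative, so a bound [M] on the whole chain bounds every single edge; this is what
    makes the induction on the cost applicable to each edge. *)
Lemma gpath_refine (E Q : pt -> pt -> Prop) (G : pt -> pt -> R) (I : pt -> Prop) M v l w :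
  (forall a b, Q a b -> 0 <= G a b /\ I b) ->
  (forall a b, I a -> Q a b -> G a b <= M ->
     exists l', gpath E a l' b /\ path_length a l' <= G a b) ->
  I v -> gpath Q v l w -> path_cost G v l <= M ->
  exists l', gpath E v l' w /\ path_length v l' <= path_cost G v l.
Proof.
intros Hpos Href. revert v; induction l as [|p l IH]; simpl; intros v Iv Hl Hc.
{ exists nil; simpl; split; [auto|lra]. }
destruct Hl as [H1 H2]. destruct (Hpos _ _ H1) as [Gp Ip].
assert (Hcost : 0 <= path_cost G p l).
{ clear - Hpos H2. revert p H2; induction l as [|q l IH]; simpl; intros p H; [lra|].
  destruct H as [A B]. specialize (IH q B). destruct (Hpos _ _ A). lra. }
destruct (Href v p Iv H1) as (l1 & P1 & L1); [lra|].
destruct (IH p Ip H2) as (l2 & P2 & L2); [lra|].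
exists (l1 ++ l2); split; [eapply gpath_app; eauto|].
rewrite (path_length_app _ _ _ _ _ P1). lra.
Qed.

(** * The constant *)

(** The supremum of the angle [mu] in the change of cones. It equals [(k + 1) * th / 2] for [x = 3]
    and [x = 4]; for [x = 5] it is the limit [phi -> PI / 2] with [j = k + 1] and
    [psi -> th / 4]. *)
Definition extreme_angle (x : nat) (th : R) : R :=
  if Nat.eqb x 4 then PI / 4 else PI / 4 + th / 8.

Lemma theta_range n : (7 <= n)%nat -> 0 < theta n /\ 7 * theta n <= 2 * PI.
Proof.
intros Hn. assert (H7 : 7 <= INR n) by (replace 7 with (INR 7) by (simpl; ring); now apply le_INR).
unfold theta. assert (Hp := PI_RGT_0). split.
- apply Rdiv_lt_0_compat; lra.
- apply (Rmult_le_reg_r (INR n)); [lra|]. field_simplify; nra.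
Qed.

Lemma theta_mul n : (7 <= n)%nat -> INR n * theta n = 2 * PI.
Proof.
intros Hn. unfold theta. field. apply not_0_INR. lia.
Qed.

Lemma extreme_angle_range x th : 0 < th -> 7 * th <= 2 * PI ->
  PI / 4 <= extreme_angle x th /\ extreme_angle x th + th / 2 < PI / 2.
Proof.
intros. unfold extreme_angle. assert (Hp := PI_RGT_0). destruct (Nat.eqb x 4); lra.
Qed.

Lemma cconst_extreme_angle x th : 0 < th -> 7 * th <= 2 * PI ->
  cconst x th = sin (extreme_angle x th) / cos (extreme_angle x th + th / 2).
Proof.
intros H1 H2. destruct (extreme_angle_range x th H1 H2) as [M1 M2].
assert (Hp := PI_RGT_0).
assert (C0 : 0 < cos (extreme_angle x th + th / 2)) by (apply cos_gt_0; lra).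
revert C0 M1 M2; unfold cconst, extreme_angle; destruct (Nat.eqb x 4); intros C0 M1 M2.
- rewrite cos_plus in *. rewrite sin_PI4, cos_PI4 in *.
  assert (Q := sqrt_lt_R0 2 ltac:(lra)).
  assert (Q1 : 0 < 1 / sqrt 2) by (apply Rdiv_lt_0_compat; lra).
  assert (cos (th / 2) - sin (th / 2) <> 0) by nra.
  field. split; lra.
- set (m := PI / 4 + th / 8) in *.
  (* Since [2 * m = PI / 2 + th / 4], the numerator is [sin (2 * m)]; the denominator becomes a
     product with the same factor [2 * cos m]. *)
  assert (E1 : cos (th / 4) = 2 * cos m * sin m).
  { replace (2 * cos m * sin m) with (2 * sin m * cos m) by ring.
    rewrite <- sin_2a, <- sin_shift, <- sin_PI_x. f_equal; unfold m; lra. }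
  assert (E2 : cos (th / 2) - sin (3 * th / 4) = 2 * cos m * cos (m + th / 2)).
  { rewrite <- (cos_shift (3 * th / 4)), form2.
    rewrite <- (sin_shift m), <- (sin_shift (m + th / 2)).
    replace ((th / 2 - (PI / 2 - 3 * th / 4)) / 2) with (- (PI / 2 - (m + th / 2)))
      by (unfold m; lra).
    replace ((th / 2 + (PI / 2 - 3 * th / 4)) / 2) with (PI / 2 - m) by (unfold m; lra).
    rewrite sin_neg. ring. }
  assert (0 < cos m) by (apply cos_gt_0; lra).
  rewrite E1, E2. field. split; lra.
Qed.

(** On this range [sin mu] increases and [cos (mu + th / 2)] decreases, so their quotient is largest
    at the right end, where it equals the constant. *)
Lemma cconst_dominates x th mu : 0 < th -> 7 * th <= 2 * PI ->
  0 <= mu <= extreme_angle x th -> sin mu <= cconst x th * cos (mu + th / 2).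
Proof.
intros H1 H2 Hm. destruct (extreme_angle_range x th H1 H2) as [M1 M2].
assert (Hp := PI_RGT_0).
rewrite cconst_extreme_angle by auto.
set (m := extreme_angle x th) in *.
assert (C0 : 0 < cos (m + th / 2)) by (apply cos_gt_0; lra).
assert (S1 : sin mu <= sin m) by (apply sin_incr_1; lra).
assert (S2 : cos (m + th / 2) <= cos (mu + th / 2)) by (apply cos_decr_1; lra).
assert (S3 : 0 < sin m) by (apply sin_gt_0; lra).
apply Rle_trans with (sin m); [auto|].
apply (Rmult_le_reg_r (cos (m + th / 2))); [auto|].
replace (sin m / cos (m + th / 2) * cos (mu + th / 2) * cos (m + th / 2))
  with (sin m * cos (mu + th / 2)) by (field; lra).
nra.
Qed.

(** The extremal angle is at least [PI / 4], where sine and cosine agree. *)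
Lemma cconst_ge_1 x th : 0 < th -> 7 * th <= 2 * PI -> 1 <= cconst x th.
Proof.
intros H1 H2. assert (Hp := PI_RGT_0).
destruct (extreme_angle_range x th H1 H2) as [M1 M2].
rewrite cconst_extreme_angle by auto.
set (m := extreme_angle x th) in *.
assert (C0 : 0 < cos (m + th / 2)) by (apply cos_gt_0; lra).
assert (C1 : cos (m + th / 2) <= cos (PI / 4)) by (apply cos_decr_1; lra).
assert (C2 : sin (PI / 4) <= sin m) by (apply sin_incr_1; lra).
rewrite sin_PI4 in C2. rewrite cos_PI4 in C1.
apply (Rmult_le_reg_r (cos (m + th / 2))); [auto|].
field_simplify; lra.
Qed.

Lemma nearest_multiple th phi : 0 < th -> th / 2 <= phi ->
  exists j : nat, (1 <= j)%nat /\ - (th / 2) <= phi - INR j * th < th / 2.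
Proof.
intros Hth Hphi.
destruct (archimed (phi / th + / 2)) as [A1 A2].
set (z := up (phi / th + / 2)) in *.
assert (B : 1 <= phi / th + / 2).
{ apply (Rmult_le_reg_r th); [auto|]. field_simplify; lra. }
assert (Hz : (1 < z)%Z) by (apply lt_IZR; simpl; lra).
(* [up] is strictly above its argument, so [z - 1] is the floor of [phi / th + 1/2]. *)
exists (Z.to_nat (z - 1)). split; [lia|].
rewrite INR_IZR_INZ, Z2Nat.id by lia. rewrite minus_IZR.
assert (E : phi = phi / th * th) by (field; lra).
split; nra.
Qed.

(* [psi] is the offset of the direction [phi] in its own cone. Both differences
   factor, and the quotient is [sin mu / cos (mu + theta/2)] with
   [mu = j theta/2 + max psi 0], which is extremal at [extreme_angle]. *)
Lemma cone_change_bound k x phi (j : nat) :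
  (1 <= k)%nat -> (3 <= x <= 5)%nat ->
  let th := theta (4 * k + x) in
  let psi := phi - INR j * th in
  th / 2 <= phi < PI / 2 -> (1 <= j)%nat -> - (th / 2) <= psi < th / 2 ->
  cos psi + cconst x th * sin (Rabs psi + th / 2)
    <= cos phi + cconst x th * sin (phi + th / 2).
Proof.
intros Hk Hx th psi Hphi Hj Hpsi.
assert (Hn : (7 <= 4 * k + x)%nat) by lia.
destruct (theta_range _ Hn) as [T1 T2]. assert (T3 := theta_mul _ Hn).
fold th in T1, T2, T3. assert (Hp := PI_RGT_0).
rewrite plus_INR, mult_INR in T3. replace (INR 4) with 4 in T3 by (simpl; ring).
(* [j * th <= phi + th / 2 < PI / 2 + th / 2 <= (k + 7/4) * th], as [PI / 2] is a quarter of
   [(4k + x) * th] and [x <= 5]. *)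
assert (Kj : (j <= k + 1)%nat).
{ apply le_S_n, INR_lt.
  assert (INR x <= 5) by (replace 5 with (INR 5) by (simpl; ring); apply le_INR; lia).
  rewrite S_INR, plus_INR. simpl.
  apply (Rmult_lt_reg_r th); [auto|]. unfold psi in Hpsi. nra. }
assert (J1 : 1 <= INR j) by (replace 1 with (INR 1) by auto; now apply le_INR).
assert (J2 : INR j * th <= (INR k + 1) * th).
{ apply Rmult_le_compat_r; [lra|]. apply le_INR in Kj. rewrite plus_INR in Kj. exact Kj. }
assert (J0 : th <= INR j * th) by nra.
assert (Ephi : phi = INR j * th + psi) by (unfold psi; ring).
clearbody psi.
assert (Mu : (INR k + 1) * th / 2 <= extreme_angle x th).
{ unfold extreme_angle. assert (X : x = 3%nat \/ x = 4%nat \/ x = 5%nat) by lia.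
  destruct X as [-> | [-> | ->]]; simpl in *; nra. }
assert (Sj : 0 < sin (INR j * th / 2)) by (apply sin_gt_0; nra).
destruct (Rle_dec 0 psi) as [L|L].
- rewrite Rabs_right by lra.
  assert (Hmu : 0 <= INR j * th / 2 + psi <= extreme_angle x th).
  { split; [nra|].
    (* For [j = k + 1] the bound on [psi] comes from [phi < PI / 2]; for smaller [j], [psi < th / 2]
       suffices. *)
    destruct (Nat.eq_dec j (k + 1)) as [->|Nj].
    - rewrite plus_INR in *. simpl (INR 1) in *. revert Mu; unfold extreme_angle.
      assert (X : x = 3%nat \/ x = 4%nat \/ x = 5%nat) by lia.
      destruct X as [-> | [-> | ->]]; simpl in *; nra.
    - assert (INR j <= INR k) by (apply le_INR; lia). nra. }
  assert (D := cconst_dominates x th _ T1 T2 Hmu).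
  assert (E1 : cos psi - cos phi
    = 2 * sin (INR j * th / 2) * sin (INR j * th / 2 + psi)).
  { rewrite form2. replace ((psi - phi) / 2) with (- (INR j * th / 2)) by lra.
    replace ((psi + phi) / 2) with (INR j * th / 2 + psi) by lra. rewrite sin_neg; ring. }
  assert (E2 : sin (phi + th / 2) - sin (psi + th / 2)
    = 2 * sin (INR j * th / 2) * cos (INR j * th / 2 + psi + th / 2)).
  { rewrite form4.
    replace ((phi + th / 2 - (psi + th / 2)) / 2) with (INR j * th / 2) by lra.
    replace ((phi + th / 2 + (psi + th / 2)) / 2)
      with (INR j * th / 2 + psi + th / 2) by lra. ring. }
  nra.
- rewrite Rabs_left by lra.
  assert (Hmu : 0 <= INR j * th / 2 <= extreme_angle x th) by nra.
  assert (D := cconst_dominates x th _ T1 T2 Hmu).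
  (* For negative [psi] this sine is the common factor of both differences; its argument is
     nonnegative because [1 <= j] and [- (th / 2) <= psi]. *)
  assert (Sp : 0 <= sin (INR j * th / 2 + psi)) by (apply sin_ge_0; nra).
  assert (E1 : cos psi - cos phi
    = 2 * sin (INR j * th / 2 + psi) * sin (INR j * th / 2)).
  { rewrite form2. replace ((psi - phi) / 2) with (- (INR j * th / 2)) by lra.
    replace ((psi + phi) / 2) with (INR j * th / 2 + psi) by lra. rewrite sin_neg; ring. }
  assert (E2 : sin (phi + th / 2) - sin (- psi + th / 2)
    = 2 * sin (INR j * th / 2 + psi) * cos (INR j * th / 2 + th / 2)).
  { rewrite form4.
    replace ((phi + th / 2 - (- psi + th / 2)) / 2) with (INR j * th / 2 + psi) by lra.
    replace ((phi + th / 2 + (- psi + th / 2)) / 2)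
      with (INR j * th / 2 + th / 2) by lra. ring. }
  nra.
Qed.

(** * Cone frames *)

(* Coordinates of [e] along and across (clockwise) the bisector of direction [cdir B]. *)
Definition frame_h (B : R) (e : pt) : R := dot e (cdir B).
Definition frame_s (B : R) (e : pt) : R := cross e (cdir B).

Ltac frame_coords :=
  unfold frame_h, frame_s, turn, orient, cross, dot, vsub, cdir in *; simpl in *.

Lemma frame_turn tau B u p q r :
  turn tau p q r
  = (frame_h B (vsub q u) - frame_h B (vsub p u))
      * (tau * frame_s B (vsub r u) - tau * frame_s B (vsub p u))
    - (frame_h B (vsub r u) - frame_h B (vsub p u))
      * (tau * frame_s B (vsub q u) - tau * frame_s B (vsub p u)).
Proof.
transitivity ((sin B * sin B + cos B * cos B) * turn tau p q r).
- assert (E := sin2_cos2 B). unfold Rsqr in E. rewrite E; ring.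
- frame_coords; ring.
Qed.

Lemma frame_sub_h B u a b : frame_h B (vsub b a) = frame_h B (vsub b u) - frame_h B (vsub a u).
Proof. frame_coords; ring. Qed.

Lemma frame_sub_s B u a b : frame_s B (vsub b a) = frame_s B (vsub b u) - frame_s B (vsub a u).
Proof. frame_coords; ring. Qed.

Lemma frame_norm B a b :
  pdist a b = sqrt (frame_h B (vsub b a) * frame_h B (vsub b a)
                    + frame_s B (vsub b a) * frame_s B (vsub b a)).
Proof.
unfold pdist, norm. f_equal.
transitivity ((sin B * sin B + cos B * cos B) * dot (vsub b a) (vsub b a)).
- assert (E := sin2_cos2 B). unfold Rsqr in E. rewrite E; ring.
- frame_coords; ring.
Qed.

Lemma frame_h_add B d e : frame_h (B + d) e = frame_h B e * cos d + frame_s B e * sin d.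
Proof. frame_coords; rewrite sin_plus, cos_plus; ring. Qed.

Lemma frame_s_add B d e : frame_s (B + d) e = frame_s B e * cos d - frame_h B e * sin d.
Proof. frame_coords; rewrite sin_plus, cos_plus; ring. Qed.

(** * Cone indices, offsets and subcones *)

Lemma cdir_period_Z b z : cdir (b + 2 * IZR z * PI) = cdir b.
Proof.
assert (N : forall b (k : nat), cdir (b + 2 * INR k * PI) = cdir b).
{ intros b' k; unfold cdir; now rewrite sin_period, cos_period. }
destruct (Z_le_dec 0 z) as [H|H].
- rewrite <- (Z2Nat.id z H), <- INR_IZR_INZ. apply N.
- rewrite <- (N (b + 2 * IZR z * PI) (Z.to_nat (- z))).
  rewrite INR_IZR_INZ, Z2Nat.id, opp_IZR by lia. f_equal; ring.
Qed.

(** Moving to neighbouring cones in either direction is done with integer indices; reduction modulo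
    [n] recovers the indices of the graph. *)
Lemma cone_index n (z : Z) : (7 <= n)%nat ->
  exists i, (i < n)%nat /\ forall t, cdir (INR i * theta n + t) = cdir (IZR z * theta n + t).
Proof.
intros Hn. assert (Hn' : (0 < Z.of_nat n)%Z) by lia.
assert (M := Z.mod_pos_bound z (Z.of_nat n) Hn').
exists (Z.to_nat (z mod Z.of_nat n)). split; [lia|]. intros t.
rewrite <- (cdir_period_Z _ (z / Z.of_nat n)). f_equal.
rewrite INR_IZR_INZ, Z2Nat.id by lia.
rewrite (Z.div_mod z (Z.of_nat n)) at 3 by lia.
rewrite plus_IZR, mult_IZR, <- INR_IZR_INZ.
assert (E := theta_mul n Hn).
replace (2 * IZR (z / Z.of_nat n) * PI) with (IZR (z / Z.of_nat n) * (2 * PI)) by ring.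
rewrite <- E. ring.
Qed.

(** The offset ranges over the whole open half-plane ahead of the bisector, so that a chain edge can
    be measured in a cone frame that does not contain it. *)
Definition offset_at (B : R) (e : pt) (t : R) : Prop :=
  - (PI / 2) < t < PI / 2 /\
  exists r, 0 < r /\ frame_h B e = r * cos t /\ frame_s B e = r * sin t.

Lemma offset_at_atan B e :
  0 < frame_h B e -> offset_at B e (atan (frame_s B e / frame_h B e)).
Proof.
intros H. set (t := atan _). assert (A := atan_bound (frame_s B e / frame_h B e)).
fold t in A. split; [lra|].
assert (C : 0 < cos t) by (apply cos_gt_0; lra).
exists (frame_h B e / cos t); repeat split.
- now apply Rdiv_lt_0_compat.
- field; lra.
- assert (T : tan t = frame_s B e / frame_h B e) by apply tan_atan.
  unfold tan in T.
  replace (frame_h B e / cos t * sin t) with (frame_h B e * (sin t / cos t)) by (field; lra).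
  rewrite T. field; lra.
Qed.

Lemma offset_at_unique B e t : offset_at B e t ->
  0 < frame_h B e /\ t = atan (frame_s B e / frame_h B e).
Proof.
intros (Ht & r & Hr & Eh & Es).
assert (C : 0 < cos t) by (apply cos_gt_0; lra).
split; [rewrite Eh; nra|].
rewrite Eh, Es. replace (r * sin t / (r * cos t)) with (tan t) by (unfold tan; field; lra).
now rewrite atan_tan.
Qed.

Lemma cone_offset_frame n u i v t : (7 <= n)%nat ->
  cone_offset n u i v t <->
  - (theta n / 2) < t < theta n / 2 /\ offset_at (INR i * theta n) (vsub v u) t.
Proof.
intros Hn. destruct (theta_range n Hn) as [T1 T2]. assert (Hp := PI_RGT_0).
unfold cone_offset, offset_at. set (B := INR i * theta n).
assert (E := sin2_cos2 B). unfold Rsqr in E.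
split; intros (Ht & H); (split; [auto|]).
- split; [lra|]. destruct H as (r & Hr & ->). exists r; repeat split; auto;
    frame_coords; rewrite sin_plus, cos_plus.
  + transitivity (r * cos t * (sin B * sin B + cos B * cos B)); [ring|rewrite E; ring].
  + transitivity (r * sin t * (sin B * sin B + cos B * cos B)); [ring|rewrite E; ring].
- destruct H as (_ & r & Hr & Eh & Es). exists r; split; auto.
  destruct v as [vx vy], u as [ux uy]. unfold cdir; simpl.
  rewrite sin_plus, cos_plus. frame_coords. f_equal.
  + replace (r * (sin B * cos t + cos B * sin t))
      with (sin B * (r * cos t) + cos B * (r * sin t)) by ring.
    rewrite <- Eh, <- Es.
    transitivity (ux + (vx - ux) * (sin B * sin B + cos B * cos B)); [rewrite E|]; ring.
  + replace (r * (cos B * cos t - sin B * sin t))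
      with (cos B * (r * cos t) - sin B * (r * sin t)) by ring.
    rewrite <- Eh, <- Es.
    transitivity (uy + (vy - uy) * (sin B * sin B + cos B * cos B)); [rewrite E|]; ring.
Qed.

(** The ends are the nearest constraint offsets around [t0], or else the boundaries of the cone. A
    constraint at [t0] itself counts as the lower end, so that [a <= t0 < b]. *)
Lemma subcone_exists n P S u i t0 : (7 <= n)%nat -> valid_constraints P S ->
  - (theta n / 2) < t0 < theta n / 2 ->
  exists a b, is_subcone n S u i a b /\ a <= t0 <= b.
Proof.
intros Hn HS Ht0.
set (off := fun z => atan (frame_s (INR i * theta n) (vsub z u)
                           / frame_h (INR i * theta n) (vsub z u))).
assert (Hoff : forall z t, cone_offset n u i z t -> t = off z).
{ intros z t [_ H]%cone_offset_frame; auto. now apply offset_at_unique in H. }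
assert (HP : forall z, is_constraint S u z -> In z P).
{ intros z Hz. now apply (constraint_in P S u z HS). }
assert (Ha : exists a, - (theta n / 2) <= a <= t0 /\
  (a = - (theta n / 2) \/ constr_offset n S u i a) /\
  forall t, a < t <= t0 -> ~ constr_offset n S u i t).
{ destruct (classic (exists z, In z P /\ is_constraint S u z /\
    cone_offset n u i z (off z) /\ off z <= t0)) as [E|E].
  - destruct (list_argmin (fun z => - off z) _ _ E) as (z & _ & (Cz & Oz & Lz) & M).
    exists (off z); repeat split; [destruct Oz; lra|auto|right; exists z; auto|].
    intros t Ht (y & Cy & Oy). assert (Ey := Hoff _ _ Oy). subst t.
    enough (- off z <= - off y) by lra.
    refine (M y (HP y Cy) (conj Cy (conj Oy _))); lra.
  - exists (- (theta n / 2)); repeat split; [lra|lra|auto|].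
    intros t Ht (y & Cy & Oy). assert (Ey := Hoff _ _ Oy). subst t.
    apply E; exists y; repeat split; auto; try apply Oy; lra. }
assert (Hb : exists b, t0 < b <= theta n / 2 /\
  (b = theta n / 2 \/ constr_offset n S u i b) /\
  forall t, t0 < t < b -> ~ constr_offset n S u i t).
{ destruct (classic (exists z, In z P /\ is_constraint S u z /\
    cone_offset n u i z (off z) /\ t0 < off z)) as [E|E].
  - destruct (list_argmin off _ _ E) as (z & _ & (Cz & Oz & Lz) & M).
    exists (off z); repeat split; [auto|destruct Oz; lra|right; exists z; auto|].
    intros t Ht (y & Cy & Oy). assert (Ey := Hoff _ _ Oy). subst t.
    enough (off z <= off y) by lra.
    refine (M y (HP y Cy) (conj Cy (conj Oy _))); lra.
  - exists (theta n / 2); repeat split; [lra|lra|auto|].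
    intros t Ht (y & Cy & Oy). assert (Ey := Hoff _ _ Oy). subst t.
    apply E; exists y; repeat split; auto; try apply Oy; lra. }
destruct Ha as (a & A1 & A2 & A3), Hb as (b & B1 & B2 & B3).
exists a, b; split; [|lra]. repeat split; auto; try lra.
intros t Ht. destruct (Rle_dec t t0); [apply A3|apply B3]; lra.
Qed.

Lemma atan_div_lt a b c d : 0 < b -> 0 < d -> a * d < c * b -> atan (a / b) < atan (c / d).
Proof.
intros Hb Hd H. apply atan_increasing.
apply (Rmult_lt_reg_r (b * d)); [nra|]. field_simplify; lra.
Qed.

Lemma atan_div_le a b c d : 0 < b -> 0 < d -> a * d <= c * b -> atan (a / b) <= atan (c / d).
Proof.
intros Hb Hd [H|H]; [left; now apply atan_div_lt|right; f_equal].
field_simplify_eq; lra.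
Qed.

(** The sign [tau] decides which of [tv], [tw] is smaller. The weak hypothesis on [turn tau u p w]
    admits [p = w]; strict bounds are wanted for constraints inside the wedge. *)
Lemma wedge_offset tau B u v w p tv tw :
  tau = 1 \/ tau = -1 ->
  offset_at B (vsub v u) tv -> offset_at B (vsub w u) tw ->
  0 < turn tau u v w -> 0 < turn tau u v p -> 0 <= turn tau u p w ->
  exists t, offset_at B (vsub p u) t /\ Rmin tv tw <= t <= Rmax tv tw /\
    (0 < turn tau u p w -> Rmin tv tw < t < Rmax tv tw).
Proof.
intros Ht [hv ->]%offset_at_unique [hw ->]%offset_at_unique HD Hv Hw.
rewrite !(frame_turn tau B u) in *.
set (V := frame_h B (vsub v u)) in *. set (W := frame_h B (vsub w u)) in *.
set (Q := frame_h B (vsub p u)) in *.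
set (v' := frame_s B (vsub v u)) in *. set (w' := frame_s B (vsub w u)) in *.
set (p' := frame_s B (vsub p u)) in *.
replace (frame_h B (vsub u u)) with 0 in * by (frame_coords; ring).
replace (frame_s B (vsub u u)) with 0 in * by (frame_coords; ring).
(* [p] is a combination of [v] and [w], seen from [u], with a positive weight on [w] and a
   nonnegative one on [v]. *)
assert (hp : 0 < Q).
{ assert (E : (V * (tau * w') - W * (tau * v')) * Q
     = (Q * (tau * w') - W * (tau * p')) * V + (V * (tau * p') - Q * (tau * v')) * W) by ring.
  assert (0 <= (Q * (tau * w') - W * (tau * p')) * V) by (apply Rmult_le_pos; lra).
  assert (0 < (V * (tau * p') - Q * (tau * v')) * W) by (apply Rmult_lt_0_compat; lra).
  assert (0 < V * (tau * w') - W * (tau * v')) by lra.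
  nra. }
exists (atan (p' / Q)); split; [now apply offset_at_atan|].
destruct Ht; subst tau.
- assert (A1 : atan (v' / V) < atan (p' / Q)) by (apply atan_div_lt; lra).
  assert (A2 : atan (p' / Q) <= atan (w' / W)) by (apply atan_div_le; lra).
  rewrite Rmin_left, Rmax_right by lra. split; [lra|]. intros H.
  assert (A3 : atan (p' / Q) < atan (w' / W)) by (apply atan_div_lt; lra). lra.
- assert (A1 : atan (p' / Q) < atan (v' / V)) by (apply atan_div_lt; lra).
  assert (A2 : atan (w' / W) <= atan (p' / Q)) by (apply atan_div_le; lra).
  rewrite Rmin_right, Rmax_left by lra. split; [lra|]. intros H.
  assert (A3 : atan (w' / W) < atan (p' / Q)) by (apply atan_div_lt; lra). lra.
Qed.

(** * The cost of a vector in a cone frame *)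

Definition height_weight (c th : R) : R := 1 / cos (th / 2) + c * tan (th / 2).

Definition cone_cost (c th B : R) (e : pt) : R :=
  height_weight c th * frame_h B e + c * Rabs (frame_s B e).

Lemma height_weight_polar c th t :
  0 < cos (th / 2) ->
  (height_weight c th * cos t + c * sin t) * cos (th / 2) = cos t + c * sin (t + th / 2).
Proof.
intros H. rewrite sin_plus. unfold height_weight, tan. field. lra.
Qed.

(** After multiplication by [cos (th / 2)] this follows from [cos (th / 2) <= cos t] and
    [0 < sin (tau * t + th / 2)]. The sideways term is signed so that it cancels the [- X v] left by
    [visible_chain_cost]. *)
Lemma edge_le_cone_cost n c tau B u v t :
  (7 <= n)%nat -> tau = 1 \/ tau = -1 -> 1 <= c ->
  - (theta n / 2) < t < theta n / 2 -> offset_at B (vsub v u) t ->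
  pdist u v <= height_weight c (theta n) * frame_h B (vsub v u)
               + c * (tau * frame_s B (vsub v u)).
Proof.
intros Hn Ht Hc Hr (_ & r & R0 & Eh & Es).
destruct (theta_range n Hn) as [T1 T2]. assert (Hp := PI_RGT_0).
set (th := theta n) in *.
assert (C0 : 0 < cos (th / 2)) by (apply cos_gt_0; lra).
assert (Ct : 0 < cos t) by (apply cos_gt_0; lra).
assert (E := height_weight_polar c th (tau * t) C0).
assert (Ec : cos (tau * t) = cos t).
{ destruct Ht; subst; [f_equal; ring|]. rewrite <- cos_neg. f_equal; ring. }
assert (Es' : sin (tau * t) = tau * sin t).
{ destruct Ht; subst; [rewrite Rmult_1_l; ring|].
  replace (-1 * t) with (- t) by ring. rewrite sin_neg; ring. }
rewrite Ec, Es' in E.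
assert (Sp : 0 < sin (tau * t + th / 2)) by (apply sin_gt_0; destruct Ht; subst; lra).
rewrite (frame_norm B), Eh, Es.
replace (r * cos t * (r * cos t) + r * sin t * (r * sin t))
  with (r * r) by (assert (Q := sin2_cos2 t); unfold Rsqr in Q; nra).
rewrite sqrt_square by lra.
assert (1 * cos (th / 2) <= cos t + sin (tau * t + th / 2)).
{ assert (cos (th / 2) <= cos t); [|lra].
  destruct (Rle_dec 0 t); [|rewrite <- (cos_neg t)]; apply cos_decr_1; lra. }
replace (height_weight c th * (r * cos t) + c * (tau * (r * sin t)))
  with (r * (height_weight c th * cos t + c * (tau * sin t))) by ring.
assert (1 <= height_weight c th * cos t + c * (tau * sin t)) by nra.
nra.
Qed.

(** * The path *)

Lemma no_boundary_direction n P p q (m : Z) : (7 <= n)%nat -> general_position n P ->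
  In p P -> In q P -> p <> q -> frame_s (IZR m * theta n + theta n / 2) (vsub q p) <> 0.
Proof.
intros Hn (G & _) Hp Hq Hpq. destruct (cone_index n m Hn) as (i & _ & Hi).
unfold frame_s. rewrite <- Hi.
replace (INR i * theta n + theta n / 2) with ((2 * INR i + 1) * (theta n / 2)) by field.
now apply G.
Qed.

Lemma cone_cost_polar c th B e r t :
  0 < cos (th / 2) -> 0 < r -> - (PI / 2) < t < PI / 2 ->
  frame_h B e = r * cos t -> frame_s B e = r * sin t ->
  cone_cost c th B e * cos (th / 2) = r * (cos (Rabs t) + c * sin (Rabs t + th / 2)).
Proof.
intros H Hr Ht Eh Es. assert (Hp := PI_RGT_0).
rewrite <- (height_weight_polar c th (Rabs t)) by auto.
unfold cone_cost. rewrite Eh, Es, Rabs_mult, (Rabs_right r) by lra.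
assert (E : cos (Rabs t) = cos t /\ sin (Rabs t) = Rabs (sin t)).
{ destruct (Rle_dec 0 t) as [L|L].
  - rewrite (Rabs_right t) by lra.
    rewrite Rabs_right; auto. apply Rle_ge, sin_ge_0; lra.
  - rewrite (Rabs_left t) by lra. rewrite cos_neg, sin_neg; split; auto.
    rewrite Rabs_left; auto. apply sin_lt_0_var; lra. }
destruct E as [-> ->]. ring.
Qed.

(** Chain edges can leave the cone only on the side of [tau], hence the one-sided bound on [t0].
    Beyond that side the direction falls in the [j]-th next cone, and [cone_change_bound] compares
    the two costs in polar form. *)
Lemma cone_change k x P z tau p q t0 :
  (1 <= k)%nat -> (3 <= x <= 5)%nat -> general_position (4 * k + x) P ->
  In p P -> In q P -> p <> q -> tau = 1 \/ tau = -1 ->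
  let th := theta (4 * k + x) in
  offset_at (IZR z * th) (vsub q p) t0 -> - (th / 2) < tau * t0 ->
  exists z' t, - (th / 2) < t < th / 2 /\ offset_at (IZR z' * th) (vsub q p) t /\
    cone_cost (cconst x th) th (IZR z' * th) (vsub q p)
      <= cone_cost (cconst x th) th (IZR z * th) (vsub q p).
Proof.
intros Hk Hx HG Hp Hq Hpq Htau th Ho Hlow.
assert (Hn : (7 <= 4 * k + x)%nat) by lia.
destruct (theta_range _ Hn) as [T1 T2]. fold th in T1, T2. assert (HPI := PI_RGT_0).
assert (C0 : 0 < cos (th / 2)) by (apply cos_gt_0; lra).
destruct (Rlt_dec (tau * t0) (th / 2)) as [L|L].
{ exists z, t0; repeat split; auto; try lra; try apply Ho; destruct Htau; subst; lra. }
set (phi := tau * t0) in *.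
destruct Ho as (Ht0 & r & Hr & Eh & Es).
assert (Hphi : th / 2 <= phi < PI / 2) by (unfold phi in *; destruct Htau; subst; lra).
destruct (nearest_multiple th phi T1) as (j & Hj & Hpsi); [lra|].
set (psi := phi - INR j * th) in *.
assert (Hz : exists z', IZR z' * th = IZR z * th + tau * (INR j * th)
   /\ exists m, IZR m * th + th / 2 = IZR z' * th - tau * (th / 2)).
{ destruct Htau; subst tau.
  - exists (z + Z.of_nat j)%Z; rewrite plus_IZR, <- INR_IZR_INZ; split; [ring|].
    exists (z + Z.of_nat j - 1)%Z; rewrite minus_IZR, plus_IZR, <- INR_IZR_INZ; field.
  - exists (z - Z.of_nat j)%Z; rewrite minus_IZR, <- INR_IZR_INZ; split; [ring|].
    exists (z - Z.of_nat j)%Z; rewrite minus_IZR, <- INR_IZR_INZ; field. }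
destruct Hz as (z' & Ez' & m & Em).
set (t := t0 - tau * (INR j * th)).
assert (Et : t = tau * psi).
{ unfold t, psi, phi. destruct Htau; subst; ring. }
assert (Eh' : frame_h (IZR z' * th) (vsub q p) = r * cos t).
{ rewrite Ez', frame_h_add, Eh, Es. unfold t. rewrite cos_minus. ring. }
assert (Es' : frame_s (IZR z' * th) (vsub q p) = r * sin t).
{ rewrite Ez', frame_s_add, Eh, Es. unfold t. rewrite sin_minus. ring. }
(* The interval from [nearest_multiple] is half-open; its closed end is the cone boundary of index
   [m], which general position excludes. *)
assert (Npsi : psi <> - (th / 2)).
{ intros E. apply (no_boundary_direction _ P p q m Hn HG Hp Hq Hpq). fold th.
  rewrite Em. replace (IZR z' * th - tau * (th / 2)) with (IZR z' * th + t)
    by (rewrite Et, E; ring).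
  rewrite frame_s_add, Eh', Es'. ring. }
assert (Ht : - (th / 2) < t < th / 2) by (rewrite Et; destruct Htau; subst tau; lra).
exists z', t; repeat split; try lra.
- exists r; auto.
- apply (Rmult_le_reg_r (cos (th / 2))); [auto|].
  rewrite (cone_cost_polar _ _ _ _ r t), (cone_cost_polar _ _ _ _ r t0) by (auto; lra).
  apply Rmult_le_compat_l; [lra|].
  assert (A1 : Rabs t0 = phi).
  { unfold phi in *. destruct Htau; subst tau; [rewrite Rabs_right|rewrite Rabs_left]; lra. }
  assert (A2 : Rabs t = Rabs psi).
  { rewrite Et, Rabs_mult.
    destruct Htau; subst tau; [rewrite Rabs_R1|rewrite Rabs_left by lra]; ring. }
  assert (A3 : cos (Rabs psi) = cos psi).
  { unfold Rabs; destruct (Rcase_abs psi); [apply cos_neg|auto]. }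
  rewrite A1, A2, A3. now apply (cone_change_bound k x phi j).
Qed.

(** The unit in which the induction measures costs; the value 1 is a default when [P] has no two
    distinct points. *)
Lemma min_distance (P : list pt) :
  exists d, 0 < d /\ forall p q, In p P -> In q P -> p <> q -> d <= pdist p q.
Proof.
destruct (classic (exists e, In e (list_prod P P) /\ fst e <> snd e)) as [E|E].
- destruct (list_argmin (fun e => pdist (fst e) (snd e)) _ _ E) as ([a b] & _ & Nab & M).
  exists (pdist a b); split.
  + unfold pdist, norm. apply sqrt_lt_R0. destruct a as [ax ay], b as [bx by_].
    simpl in Nab. coords.
    assert (A := Rle_0_sqr (bx - ax)). assert (A' := Rle_0_sqr (by_ - ay)).
    destruct (Req_dec bx ax) as [->|N].
    * assert (B := Rlt_0_sqr (by_ - ay) ltac:(intros H; apply Nab; f_equal; lra)).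
      unfold Rsqr in *; lra.
    * assert (B := Rlt_0_sqr (bx - ax) ltac:(lra)). unfold Rsqr in *; lra.
  + intros p q Hp Hq Hpq. apply (M (p, q)); auto. now apply in_prod.
- exists 1; split; [lra|]. intros p q Hp Hq Hpq. exfalso; apply E.
  exists (p, q); split; auto. now apply in_prod.
Qed.

(** The first edge has length at least [d], so every edge of the remaining chain costs at most the
    total minus [d]. The cone [z] varies in the induction because chain edges are treated in their
    own cones. *)
Lemma cone_path k x P S d (N : nat) :
  (1 <= k)%nat -> (3 <= x <= 5)%nat -> general_position (4 * k + x) P ->
  valid_constraints P S ->
  0 < d -> (forall p q, In p P -> In q P -> p <> q -> d <= pdist p q) ->
  let th := theta (4 * k + x) in
  let c := cconst x th in
  forall (z : Z) u w t, In u P -> In w P -> sees S u w ->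
  - (th / 2) < t < th / 2 -> offset_at (IZR z * th) (vsub w u) t ->
  cone_cost c th (IZR z * th) (vsub w u) < INR N * d ->
  exists l, gpath (ctheta_edge (4 * k + x) P S) u l w /\
    path_length u l <= cone_cost c th (IZR z * th) (vsub w u).
Proof.
intros Hk Hx HG HS Hd0 Hd th c.
assert (Hn : (7 <= 4 * k + x)%nat) by lia.
destruct (theta_range _ Hn) as [T1 T2]. fold th in T1, T2. assert (HPI := PI_RGT_0).
assert (Hc : 1 <= c) by (apply cconst_ge_1; auto).
assert (C0 : 0 < cos (th / 2)) by (apply cos_gt_0; lra).
assert (Hw0 : 0 < height_weight c th).
{ unfold height_weight. assert (0 < tan (th / 2)) by (apply tan_gt_0; lra).
  assert (0 < 1 / cos (th / 2)) by (apply Rdiv_lt_0_compat; lra). nra. }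
assert (Hcol : no_three_collinear P) by exact (proj2 (proj2 HG)).
induction N as [|N IH]; intros z u w tw Hu Hw Suw Htw Ow Hrank.
{ destruct (offset_at_unique _ _ _ Ow) as [hw _].
  assert (A := Rabs_pos (frame_s (IZR z * th) (vsub w u))).
  unfold cone_cost in Hrank. simpl in Hrank. nra. }
destruct (cone_index _ z Hn) as (i & Hi & Edir). fold th in Edir.
specialize (Edir 0). rewrite !Rplus_0_r in Edir.
assert (Fh : forall e, frame_h (IZR z * th) e = frame_h (INR i * th) e)
  by (intros e; unfold frame_h; now rewrite Edir).
assert (Fs : forall e, frame_s (IZR z * th) e = frame_s (INR i * th) e)
  by (intros e; unfold frame_s; now rewrite Edir).
assert (FO : forall e t, offset_at (IZR z * th) e t <-> offset_at (INR i * th) e t)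
  by (intros e t; unfold offset_at; rewrite Fh, Fs; tauto).
destruct (subcone_exists _ P S u i tw Hn HS Htw) as (a & b & Hab & Htab).
destruct (list_argmin (bis_proj (4 * k + x) u i)
  (fun y => in_subcone (4 * k + x) u i a b y /\ sees S u y) P) as (v & Hv & (Iv & Sv) & Mv).
{ exists w; repeat split; auto. exists tw; split; auto.
  apply cone_offset_frame; auto. split; auto. now apply FO. }
assert (Ev : ctheta_edge (4 * k + x) P S u v).
{ left; repeat split; auto. exists i, a, b; auto 10. }
destruct Iv as (tv & Ov & Hvab).
apply cone_offset_frame in Ov as [Htv Ov]; auto. fold th in Htv, Ov.
apply FO in Ov.
destruct (offset_at_unique _ _ _ Ow) as [hw Etw].
destruct (offset_at_unique _ _ _ Ov) as [hv _].
destruct (classic (v = w)) as [->|Nvw].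
{ exists (w :: nil); simpl; repeat split; auto.
  destruct (Rle_dec 0 (frame_s (IZR z * th) (vsub w u))) as [L|L].
  - assert (A := edge_le_cone_cost _ c 1 (IZR z * th) u w tw Hn (or_introl eq_refl) Hc Htw Ow).
    unfold cone_cost. rewrite Rabs_right by lra. fold th in A. lra.
  - assert (A := edge_le_cone_cost _ c (-1) (IZR z * th) u w tw Hn (or_intror eq_refl) Hc Htw Ow).
    unfold cone_cost. rewrite Rabs_left by lra. fold th in A. lra. }
assert (Huu : frame_h (IZR z * th) (vsub u u) = 0 /\ frame_s (IZR z * th) (vsub u u) = 0)
  by (split; frame_coords; ring).
destruct Huu as [Hu0 Hu1].
assert (Nuv : u <> v) by (intros <-; lra).
assert (Nuw : u <> w) by (intros <-; lra).
assert (Htau : exists tau, (tau = 1 \/ tau = -1) /\ 0 < turn tau u v w).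
{ assert (O : orient u w v <> 0) by (apply Hcol; auto).
  destruct (Rlt_dec 0 (orient u w v)); [exists 1|exists (-1)]; unfold turn; split; auto; lra. }
destruct Htau as (tau & Htau & HD).
assert (Htt : tau * tau = 1) by (destruct Htau; subst; ring).
set (h := fun y => frame_h (IZR z * th) (vsub y u)).
set (X := fun y => tau * frame_s (IZR z * th) (vsub y u)).
assert (Hmm : a <= Rmin tv tw /\ Rmax tv tw <= b
   /\ - (th / 2) < Rmin tv tw /\ Rmax tv tw < th / 2).
{ unfold Rmin, Rmax. destruct (Rle_dec tv tw); lra. }
(* Both [tv] and [tw] lie in the subcone, so a constraint strictly between [uv] and [uw] would split
   it. *)
assert (Hfree : forall y, is_constraint S u y ->
  ~ (0 < turn tau u v y /\ 0 < turn tau u y w)).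
{ intros y Hy [A B].
  destruct (wedge_offset tau _ u v w y tv tw Htau Ov Ow) as (t & Ot & _ & Ht); auto; [lra|].
  specialize (Ht B). destruct Hab as (_ & _ & _ & _ & _ & Hno).
  apply (Hno t); [lra|]. exists y; split; auto. apply cone_offset_frame; auto.
  fold th. split; [lra|now apply FO]. }
destruct (visible_chain_exists P S tau u v w) as (l & Hl); auto.
destruct (visible_chain_cost P S tau u w v l h X (height_weight c th) c)
  as (Hpath & Hcost & _); auto; try lra.
- intros; apply frame_turn.
- unfold X; rewrite Hu1; ring.
- intros p Hhd. destruct l as [|p' l]; [easy|]. injection Hhd as ->.
  inversion_clear Hl as [|? ? ? Hp Sup ? ? Qp ? ?].
  assert (Tp : 0 < turn tau u v p) by (destruct Qp as [->|(? & _)]; auto).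
  destruct (wedge_offset tau _ u v w p tv tw Htau Ov Ow) as (t & Ot & Ht & _); auto.
  { destruct Qp as [->|(_ & _ & A)]; [|lra].
    destruct (turn_degenerate tau u w) as (Z & _); lra. }
  (* The first chain vertex lies in the same subcone and is visible from [u], so it competes with
     [v]; general position makes the inequality strict. *)
  assert (Lp : bis_proj (4 * k + x) u i v <= bis_proj (4 * k + x) u i p).
  { apply Mv; auto. split; auto. exists t; split; [|lra].
    apply cone_offset_frame; auto. fold th. split; [lra|now apply FO]. }
  assert (Np : dot (vsub p v) (cdir (INR i * th)) <> 0).
  { apply (proj1 (proj2 HG)); auto. intros <-. destruct (turn_degenerate tau u v) as (Z & _); lra. }
  change (bis_proj (4 * k + x) u i) with (fun y => frame_h (INR i * th) (vsub y u)) in Lp.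
  simpl in Lp. change (frame_h (INR i * th) (vsub p v) <> 0) in Np.
  rewrite (frame_sub_h _ u) in Np. unfold h. rewrite !Fh. lra.
- assert (Duv := edge_le_cone_cost _ c tau _ u v tv Hn Htau Hc Htv Ov).
  fold th in Duv. assert (Dd := Hd u v Hu Hv Nuv).
  assert (Xw : Rabs (X w) = Rabs (frame_s (IZR z * th) (vsub w u))).
  { unfold X; rewrite Rabs_mult.
    destruct Htau; subst tau; [rewrite Rabs_R1|rewrite (Rabs_left (-1)) by lra]; ring. }
  rewrite S_INR in Hrank.
  assert (Hsum : pdist u v + path_cost (frame_cost (height_weight c th) c h X) v l
     <= cone_cost c th (IZR z * th) (vsub w u)).
  { unfold cone_cost. rewrite <- Xw. unfold h, X in *. lra. }
  destruct (gpath_refine (ctheta_edge (4 * k + x) P S) (chain_edge P S h X w)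
    (frame_cost (height_weight c th) c h X) (fun y => In y P)
    (cone_cost c th (IZR z * th) (vsub w u) - d) v l w) as (l' & Hl' & Ll'); auto; try lra.
  + intros p q (Hq & _ & Hpq & _); split; auto. unfold frame_cost.
    assert (A := Rabs_pos (X q - X p)). nra.
  + intros p q Hp (Hq & Spq & Hpq & Hdir) Hle.
    assert (Npq : p <> q) by (intros <-; lra).
    assert (hpq : 0 < frame_h (IZR z * th) (vsub q p))
      by (rewrite (frame_sub_h _ u); unfold h in Hpq; lra).
    assert (Opq := offset_at_atan _ _ hpq).
    assert (Ecost : frame_cost (height_weight c th) c h X p q
      = cone_cost c th (IZR z * th) (vsub q p)).
    { unfold frame_cost, cone_cost, h, X.
      rewrite (frame_sub_h _ u p q), (frame_sub_s _ u p q), <- Rmult_minus_distr_l, Rabs_mult.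
      destruct Htau; subst tau; [rewrite Rabs_R1|rewrite (Rabs_left (-1)) by lra]; ring. }
    destruct (cone_change k x P z tau p q _ Hk Hx HG Hp Hq Npq Htau Opq)
      as (z' & t' & Ht' & Ot' & Lt').
    { fold th.
      (* The slope condition of [chain_edge] puts [pq] on the [tau] side of [uw], whose own offset
         is already above the cone boundary. *)
      assert (At : tau * tw <= tau * atan (frame_s (IZR z * th) (vsub q p)
                                          / frame_h (IZR z * th) (vsub q p))).
      { rewrite Etw. unfold h, X in Hdir.
        rewrite <- Rmult_minus_distr_l, <- (frame_sub_s _ u), <- (frame_sub_h _ u) in Hdir.
        destruct Htau; subst tau.
        - rewrite !Rmult_1_l. apply atan_div_le; auto. lra.
        - assert (Q := atan_div_le (frame_s (IZR z * th) (vsub q p)) (frame_h (IZR z * th) (vsub q p))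
            (frame_s (IZR z * th) (vsub w u)) (frame_h (IZR z * th) (vsub w u)) hpq hw).
          specialize (Q ltac:(lra)). lra. }
      destruct Htau; subst tau; lra. }
    fold th c in Ht', Ot', Lt'.
    destruct (IH z' p q t') as (l' & P' & L'); auto; [lra|].
    exists l'; split; auto. lra.
  + exists (v :: l'); simpl; split; auto. lra.
Qed.

(** [m] is the orthogonal projection of [w] on the bisector, so [cos alpha * |uw|] is the height of
    [w] and [sin alpha * |uw|] its distance from the bisector. *)
Lemma cone_cost_bound c th B (u w m : pt) :
  0 < frame_h B (vsub w u) ->
  m = (fst u + frame_h B (vsub w u) * fst (cdir B),
       snd u + frame_h B (vsub w u) * snd (cdir B)) ->
  let alpha := vangle (vsub w u) (vsub m u) in
  (cos alpha / cos (th / 2) + (cos alpha * tan (th / 2) + sin alpha) * c) * pdist u w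
  = cone_cost c th B (vsub w u).
Proof.
intros Hh Hm alpha.
set (h := frame_h B (vsub w u)) in *.
set (s := frame_s B (vsub w u)).
assert (ED : pdist u w = sqrt (h * h + s * s)) by apply frame_norm.
assert (Dp : 0 < pdist u w) by (rewrite ED; apply sqrt_lt_R0; nra).
assert (DD : pdist u w * pdist u w = h * h + s * s)
  by (rewrite ED; apply sqrt_sqrt; nra).
assert (Em : vsub m u = (h * sin B, h * cos B)).
{ rewrite Hm; unfold vsub, cdir; simpl; f_equal; ring. }
assert (Nm : norm (vsub m u) = h).
{ unfold norm; rewrite Em; unfold dot; simpl.
  replace (h * sin B * (h * sin B) + h * cos B * (h * cos B)) with (h * h).
  - apply sqrt_square; lra.
  - assert (Q := sin2_cos2 B); unfold Rsqr in Q; nra. }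
assert (Dm : dot (vsub w u) (vsub m u) = h * h).
{ rewrite Em. unfold h at 3, frame_h, dot, cdir; simpl. ring. }
assert (Ea : alpha = acos (h / pdist u w)).
{ unfold alpha, vangle. rewrite Nm, Dm. f_equal.
  change (norm (vsub w u)) with (pdist u w). field; lra. }
assert (H1 : -1 <= h / pdist u w <= 1).
{ assert (0 < h / pdist u w) by (apply Rdiv_lt_0_compat; lra). split; [lra|].
  apply (Rmult_le_reg_r (pdist u w)); [auto|].
  replace (h / pdist u w * pdist u w) with h by (field; lra). nra. }
assert (Ec : cos alpha * pdist u w = h).
{ rewrite Ea, cos_acos by lra. field; lra. }
assert (Es : sin alpha * pdist u w = Rabs s).
{ rewrite Ea, sin_acos by lra.
  replace (1 - (h / pdist u w)²) with ((Rabs s / pdist u w) * (Rabs s / pdist u w)).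
  - rewrite sqrt_square; [field; lra|].
    apply Rmult_le_pos; [apply Rabs_pos|left; now apply Rinv_0_lt_compat].
  - assert (Q : Rabs s * Rabs s = s * s) by apply (eq_sym (Rsqr_abs s)).
    unfold Rsqr. apply (Rmult_eq_reg_r (pdist u w * pdist u w)); [|nra].
    field_simplify; [|lra|lra]. nra. }
unfold cone_cost, height_weight. fold h s. rewrite <- Es.
replace (h) with (cos alpha * pdist u w) at 1.
unfold Rdiv. ring.
Qed.

Theorem theorem2 (k x : nat) (P : list pt) (S : list (pt * pt)) (u w : pt) :
  (1 <= k)%nat -> (3 <= x <= 5)%nat ->
  general_position (4 * k + x) P ->
  valid_constraints P S ->
  In u P -> In w P -> sees S u w ->
  forall i : nat, (i < 4 * k + x)%nat -> in_cone (4 * k + x) u i w ->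
  let th := theta (4 * k + x) in
  (* m: midpoint of the side of T_uw opposite u, on the bisector of C_i^u *)
  let m := (fst u + bis_proj (4 * k + x) u i w * fst (cdir (INR i * th)),
            snd u + bis_proj (4 * k + x) u i w * snd (cdir (INR i * th))) in
  let alpha := vangle (vsub w u) (vsub m u) in
  exists l : list pt,
    gpath (ctheta_edge (4 * k + x) P S) u l w /\
    path_length u l <=
      (cos alpha / cos (th / 2)
       + (cos alpha * tan (th / 2) + sin alpha) * cconst x th) * pdist u w.
Proof.
intros Hk Hx HG HS Hu Hw Suw i Hi [t Ht] th m alpha.
assert (Hn : (7 <= 4 * k + x)%nat) by lia.
apply cone_offset_frame in Ht as [Ht Ot]; auto. fold th in Ht, Ot.
destruct (offset_at_unique _ _ _ Ot) as [hw _].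
unfold alpha. rewrite (cone_cost_bound (cconst x th) th (INR i * th) u w m hw eq_refl).
destruct (min_distance P) as (d & Hd0 & Hd).
set (c := cone_cost _ _ _ _).
(* Any [N] with [c < N * d] starts the induction; here [c] denotes the total cost. *)
destruct (INR_unbounded (c / d)) as (N & HN).
rewrite INR_IZR_INZ in Ot.
destruct (cone_path k x P S d N Hk Hx HG HS Hd0 Hd (Z.of_nat i) u w t) as (l & Hl & Ll);
  auto; fold th.
- rewrite <- INR_IZR_INZ. fold c.
  replace c with (c / d * d) by (field; lra). now apply Rmult_lt_compat_r.
- exists l; split; auto. unfold c. now rewrite INR_IZR_INZ.
Qed.
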